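(* Let $s \geq 0$, $\tilde r > 0$, $M = sI + \tilde r K_n$, $r = s + \tilde r$ and $\mu = \tilde r / r \in (0,1]$, where $K_n \in \mathbb{C}^{n\times n}$ ($n \geq 2$) has as its field of values the closed unit disk. Let $\phi_j \in (0,\pi)$. Then the sequence $\{\phi_k\}_{k \geq j}$ produced by Uhlig's cutting procedure applied sequentially to the clockwise corners $\{c_k\}$ (as described in the context), which satisfies the recursion $$\phi_{k+1} = \arctan\left(\mu \tan \tfrac12 \phi_k\right) \quad \text{for all } k \geq j,$$ converges to zero Q-linearly with rate $\tfrac12 \mu$.
   Context: The field of values of $A\in\mathbb{C}^{n\times n}$ is $W(A) = \{x^*Ax : \|x\|=1\}$ and its numerical radius is $r(A) = \max\{|z| : z \in W(A)\}$. For an angle $\theta$, $L_\theta$ denotes the supporting line $\{e^{-\mathbf{i}\theta}(\lambda_\theta + \mathbf{i}t): t \in \mathbb{R}\}$ of $W(M)$, where $\lambda_\theta$ is the largest eigenvalue of $\tfrac12(e^{\mathbf{i}\theta}M + e^{-\mathbf{i}\theta}M^* )$. $W(M)$ is the closed disk of radius $\tilde r$ centered at $s$ on the real axis, with outermost point $b_\star = s + \tilde r = r = r(M)$. The line $L_0$ is the vertical tangent to $W(M)$ at $b_\star$. For $\phi \in (0,\pi)$, the line $L_{-\phi}$ is the tangent to $W(M)$ at the boundary point $s + \tilde r e^{\mathbf{i}\phi}$. Sequence of clockwise corners: start from the boundary point $b_j = s + \tilde r e^{\mathbf{i}\phi_j}$ with $\phi_j = \operatorname{Arg}(b_j - s)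 \in (0,\pi)$. For $k \geq j$, given the boundary point $b_k = s + \tilde r e^{\mathbf{i}\phi_k}$, let $c_k = L_0 \cap L_{-\phi_k}$ be the corner of the polygonal outer approximation lying between $b_\star$ and $b_k$. Uhlig's cut of $c_k$ uses the supporting line $L_{\theta_{k+1}}$ with $\theta_{k+1} = -\operatorname{Arg}(c_k)$, giving the new boundary point $b_{k+1}$ of $W(M)$ on $L_{\theta_{k+1}}$, and $\phi_{k+1} = \operatorname{Arg}(b_{k+1} - s)$. The next corner to be cut is $c_{k+1} = L_0 \cap L_{\theta_{k+1}}$, and so on. A sequence $\{x_k\}$ with $x_k \neq x_\star$ converges to $x_\star$ Q-linearly with rate $q \in (0,1)$ if $x_k \to x_\star$ and $\lim_{k\to\infty} |x_{k+1} - x_\star|/|x_k - x_\star| = q$. *)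

(* Defs.v *)
From mathcomp Require Import all_boot all_order all_algebra.
From mathcomp Require Import all_classical all_reals all_analysis.
From mathcomp Require Export complex.

Set Implicit Arguments.
Unset Strict Implicit.
Unset Printing Implicit Defensive.
Import Order.TTheory GRing.Theory Num.Theory.
Import numFieldNormedType.Exports.

Local Open Scope classical_set_scope.
Local Open Scope sesquilinear_scope.
Local Open Scope complex_scope.
Local Open Scope ring_scope.

Section ComplexNumbers.
Variable R : realType.

Definition expi (t : R) : R[i] := cos t +i* sin t.

(* Principal argument, in ]-pi, pi]; it is only meaningful for z <> 0. *)
Definition Arg (z : R[i]) : R :=
  xget 0 [set t : R | - pi < t <= pi /\ z = `|z| * expi t].

End ComplexNumbers.

Section FieldOfValues.
Variables (R : realType) (n : nat).

Definition vnorm (x : 'cV[R[i]]_n) : R[i] :=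
  sqrtC (\sum_(i < n) `|x i 0| ^+ 2).

Definition field_of_values (A : 'M[R[i]]_n) : set R[i] :=
  [set (x ^t* *m A *m x) 0 0 | x in [set x : 'cV[R[i]]_n | vnorm x = 1]].

Definition rotated_hermitian_part (A : 'M[R[i]]_n) (theta : R) : 'M[R[i]]_n :=
  2^-1 *: (expi theta *: A + expi (- theta) *: A ^t*).

(* The matrix is Hermitian, so its eigenvalues are real; there are finitely
   many of them, and at least one when 0 < n, so the supremum is a maximum. *)
Definition lambda_max (A : 'M[R[i]]_n) (theta : R) : R :=
  sup [set x : R | eigenvalue (rotated_hermitian_part A theta) x%:C].

Definition supporting_line (A : 'M[R[i]]_n) (theta : R) : set R[i] :=
  [set expi (- theta) * (lambda_max A theta +i* t) | t in [set: R]].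

(* W(M) is meant to be the closed disk of center s and radius rt.
   The entries of index < j are irrelevant. *)
Record uhlig_clockwise_cuts (M : 'M[R[i]]_n) (s rt : R) (j : nat)
    (phi theta : nat -> R) (b c : nat -> R[i]) : Prop := UhligClockwiseCuts {
  start_point : b j = s%:C + rt%:C * expi (phi j);
  corner : forall k, (j <= k)%N ->
    (supporting_line M 0 `&` supporting_line M (- phi k)) (c k);
  cut_angle : forall k, (j <= k)%N -> theta k.+1 = - Arg (c k);
  (* A point of W(M) lying on a supporting line is a boundary point. *)
  cut_point : forall k, (j <= k)%N ->
    (field_of_values M `&` supporting_line M (theta k.+1)) (b k.+1);
  point_angle : forall k, (j <= k)%N -> phi k.+1 = Arg (b k.+1 - s%:C) }.

End FieldOfValues.

Definition Qlinear (R : realType) (j : nat) (x : nat -> R) (l q : R) : Prop :=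
  [/\ 0 < q < 1,
      forall k, (j <= k)%N -> x k != l,
      x k @[k --> \oo] --> l
    & `|x k.+1 - l| / `|x k - l| @[k --> \oo] --> q].

(* Main.v *)
Require Import Defs.
From mathcomp Require Import all_boot all_order all_algebra.
From mathcomp Require Import all_classical all_reals all_analysis.
From mathcomp Require Import ring lra.
Set Implicit Arguments.
Unset Strict Implicit.
Unset Printing Implicit Defensive.
Import Order.TTheory GRing.Theory Num.Theory.
Import numFieldNormedType.Exports.
Local Open Scope classical_set_scope.
Local Open Scope sesquilinear_scope.
Local Open Scope complex_scope.
Local Open Scope ring_scope.

(** The largest eigenvalue of the Hermitian part of [expi theta *: M] is the
maximum of [Re (expi theta * z)] over [W(M)]: a unit vector at which the form of
a positive semidefinite matrix vanishes lies in its kernel, so that a vector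
attaining the maximum is an eigenvector. For the disk of center [s] and radius
[rt] this gives [lambda_theta = s cos theta + rt], so [L_theta] touches the disk
only at [s + rt expi (- theta)], hence [phi_(k+1) = Arg c_k]. Solving for the
corner gives [c_k = r + i rt tan (phi_k / 2)], which is the recursion. The map
[x |-> atan (mu tan (x / 2))] is at most [x / 2] and has derivative [mu / 2]
at [0]. *)

(** * Conjugate transposes and positive semidefinite forms *)

Lemma trmxC_mul (C : numClosedFieldType) m n p (A : 'M[C]_(m, n))
    (B : 'M[C]_(n, p)) : (A *m B)^t* = B^t* *m A^t*.
Proof. by rewrite trmx_mul map_mxM. Qed.

Lemma trmxCD (C : numClosedFieldType) m n (A B : 'M[C]_(m, n)) :
  (A + B)^t* = A^t* + B^t*.
Proof. by rewrite linearD /= map_mxD. Qed.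

Lemma trmxCZ (C : numClosedFieldType) m n (a : C) (A : 'M[C]_(m, n)) :
  (a *: A)^t* = a^* *: A^t*.
Proof. by rewrite linearZ /= map_mxZ. Qed.

Lemma mul_trmxCE (C : numClosedFieldType) n (x : 'cV[C]_n) :
  (x^t* *m x) 0 0 = \sum_i `|x i 0| ^+ 2.
Proof. by rewrite mxE; apply: eq_bigr => i _; rewrite !mxE normCK mulrC. Qed.

Lemma mul_trmxC_ge0 (C : numClosedFieldType) n (x : 'cV[C]_n) :
  0 <= (x^t* *m x) 0 0.
Proof. by rewrite mul_trmxCE sumr_ge0 // => i _; rewrite exprn_ge0. Qed.

Lemma mul_trmxC_eq0 (C : numClosedFieldType) n (x : 'cV[C]_n) :
  ((x^t* *m x) 0 0 == 0) = (x == 0).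
Proof.
apply/idP/eqP => [|->]; last by rewrite mulmx0 mxE eqxx.
rewrite mul_trmxCE psumr_eq0 => [/allP x0|i _]; last by rewrite exprn_ge0.
apply/matrixP => i k; rewrite ord1 mxE; apply/eqP.
by rewrite -normr_eq0 -sqrf_eq0 (implyP (x0 i (mem_index_enum _))).
Qed.

(** With [w = P x], [N] the squared norm of [w] and [c] the form at [w], the form at
    [(c + 1) x - N w] equals [- N^2 (c + 2)], so positivity forces [N = 0]. The factor [c + 1]
    replaces the choice of a small step. *)
Lemma psd_form_eq0 (C : numClosedFieldType) n (P : 'M[C]_n) (x : 'cV[C]_n) :
  P^t* = P -> (forall y : 'cV_n, 0 <= (y^t* *m P *m y) 0 0) ->
  (x^t* *m P *m x) 0 0 = 0 -> P *m x = 0.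
Proof.
move=> Ph Ppos Px0; set w := P *m x.
set N := (w^t* *m w) 0 0; set c := (w^t* *m P *m w) 0 0.
have N0 : 0 <= N by exact: mul_trmxC_ge0.
have c0 : 0 <= c by exact: Ppos.
have c1real : (c + 1)^* = c + 1 by rewrite geC0_conj // addr_ge0.
have Nreal : (- N)^* = - N by rewrite rmorphN /= geC0_conj.
(* moving from x in the direction - P x decreases the form to first order *)
have := Ppos ((c + 1) *: x + (- N) *: w).
have wP : x^t* *m P = w^t* by rewrite trmxC_mul Ph.
rewrite trmxCD !trmxCZ c1real Nreal !mulmxDl !mulmxDr -!scalemxAl -!scalemxAr.
have wPx : w^t* *m P *m x = w^t* *m w by rewrite -mulmxA.
have wx0 : (w^t* *m x) 0 0 = 0 by rewrite -wP.
have mxD (A B : 'M[C]_1) : (A + B) 0 0 = A 0 0 + B 0 0 by rewrite mxE.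
have mxZ a (A : 'M[C]_1) : (a *: A) 0 0 = a * A 0 0 by rewrite mxE.
rewrite wP wPx !(mxD, mxZ) wx0 -/N -/c.
have -> : (c + 1) * ((c + 1) * 0) + (c + 1) * (- N * N) +
    (- N * ((c + 1) * N) + - N * (- N * c)) = - (N ^+ 2 * (c + 2)) by ring.
rewrite oppr_ge0 pmulr_lle0 ?ltr_wpDl// => N2.
have /eqP : N ^+ 2 == 0 by rewrite eq_le N2 exprn_ge0.
by move/eqP; rewrite sqrf_eq0 mul_trmxC_eq0 => /eqP.
Qed.

(** * Largest eigenvalue of the rotated Hermitian part *)

Section LambdaMax.
Variables (R : realType) (n : nat).
Implicit Types (A : 'M[R[i]]_n) (x : 'cV[R[i]]_n).

Lemma vnormE x : vnorm x ^+ 2 = (x^t* *m x) 0 0.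
Proof. by rewrite /vnorm sqrtCK mul_trmxCE. Qed.

Lemma vnorm_ge0 x : 0 <= vnorm x.
Proof. by rewrite sqrtC_ge0 sumr_ge0 // => i _; rewrite exprn_ge0. Qed.

Lemma vnorm_eq0 x : (vnorm x == 0) = (x == 0).
Proof. by rewrite -sqrf_eq0 vnormE mul_trmxC_eq0. Qed.

Lemma expiN (t : R) : expi (- t) = (expi t)^*%C.
Proof. by rewrite /expi cosN sinN. Qed.

(** The form of [A^t*] is the conjugate of the form of [A], so the two summands average to a real
    part. *)
Lemma rotated_hermitian_partE A theta x :
  (x^t* *m rotated_hermitian_part A theta *m x) 0 0 =
  (complex.Re (expi theta * (x^t* *m A *m x) 0 0))%:C.
Proof.
have -> z : (complex.Re (expi theta * z))%:C =
    2^-1 * (expi theta * z + expi (- theta) * z^*%C).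
  by rewrite ReJ_add expiN [RHS]mulrC rmorphM.
have -> : ((x^t* *m A *m x) 0 0)^*%C = (x^t* *m A^t* *m x) 0 0.
  transitivity (((x^t* *m A *m x)^t*) 0 0); first by rewrite !mxE.
  by rewrite !trmxC_mul trmxCK mulmxA.
rewrite /rotated_hermitian_part -scalemxAr mulmxDr -scalemxAl mulmxDl.
by rewrite -!scalemxAr -!scalemxAl !mxE mulrC.
Qed.

Lemma rotated_hermitian_part_herm A theta :
  (rotated_hermitian_part A theta)^t* = rotated_hermitian_part A theta.
Proof.
rewrite /rotated_hermitian_part trmxCZ trmxCD !trmxCZ trmxCK addrC.
congr (_ *: (_ *: _ + _ *: _)).
- by rewrite fmorphV /= conjC_nat.
- by rewrite expiN; apply: conjcK.
- by rewrite expiN.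
Qed.

Lemma vnorm_normalize x : x != 0 ->
  exists2 u : 'cV[R[i]]_n, vnorm u = 1 & x = vnorm x *: u.
Proof.
move=> x0; have nx0 : vnorm x != 0 by rewrite vnorm_eq0.
exists ((vnorm x)^-1 *: x); last by rewrite scalerA divff ?scale1r.
have conjV : ((vnorm x)^-1)^* = (vnorm x)^-1.
  by rewrite geC0_conj // invr_ge0 vnorm_ge0.
apply/eqP; rewrite -(@eqrXn2 _ 2) ?vnorm_ge0 // expr1n vnormE trmxCZ conjV.
by rewrite -scalemxAl -scalemxAr 2!mxE -vnormE expr2 mulKf // mulVf.
Qed.

(** The bound makes [m I - H] positive semidefinite, which caps every eigenvalue of [H]; the point
    attaining it supplies an eigenvector for [m]. *)
Lemma lambda_max_support A theta (m : R) :
  (forall z, field_of_values A z -> complex.Re (expi theta * z) <= m) ->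
  (exists2 z, field_of_values A z & complex.Re (expi theta * z) = m) ->
  lambda_max A theta = m.
Proof.
move=> Wle [_ [x x1 <-] xm].
set H := rotated_hermitian_part A theta.
have Hh : H^t* = H by exact: rotated_hermitian_part_herm.
have formE y : (y^t* *m (m%:C%:M - H) *m y) 0 0 =
    m%:C * vnorm y ^+ 2 - (y^t* *m H *m y) 0 0.
  rewrite mulmxBr mulmxBl mul_mx_scalar -scalemxAl vnormE.
  by rewrite mxE [X in X + _]mxE [X in _ + X]mxE.
(* The bound concerns unit vectors and extends to all [y] by homogeneity. *)
have pos (y : 'cV_n) : 0 <= (y^t* *m (m%:C%:M - H) *m y) 0 0.
  have [->|y0] := eqVneq y 0; first by rewrite mulmx0 mxE.
  have [u u1 ->] := vnorm_normalize y0; set k := vnorm y.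
  have kr : k^* = k by rewrite geC0_conj // vnorm_ge0.
  rewrite trmxCZ kr -!scalemxAl -!scalemxAr mxE mxE mulrA mulr_ge0 //.
    by rewrite mulr_ge0 ?vnorm_ge0.
  rewrite formE u1 expr1n mulr1 rotated_hermitian_partE subr_ge0 lecR.
  by apply: Wle; exists u.
have Hx : H *m x = m%:C *: x.
  apply/esym/eqP; rewrite -subr_eq0 -mul_scalar_mx -mulmxBl; apply/eqP.
  apply: psd_form_eq0 => //.
    rewrite linearB /= map_mxB; congr (_ - _).
      by rewrite tr_scalar_mx map_scalar_mx /=; congr (_%:M); apply: conjc_real.
    exact: Hh.
  by rewrite formE x1 expr1n mulr1 rotated_hermitian_partE xm subrr.
have eigm : eigenvalue H m%:C.
  (* Eigenvectors are row vectors here, hence the conjugate transpose of [x]; [H] is Hermitian and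
     [m] real. *)
  apply/eigenvalueP; exists (x^t*).
    have := congr1 (fun B : 'cV_n => B^t*) Hx.
    rewrite /= trmxC_mul Hh trmxCZ => ->.
    by congr (_ *: _); apply: conjc_real.
  apply/eqP => x0; have := oner_eq0 R[i]; rewrite -x1 vnorm_eq0.
  by rewrite -[x]trmxCK x0 trmx0 map_mx0 eqxx.
have eig_le : ubound [set a : R | eigenvalue H a%:C] m.
  move=> a /= /eigenvalueP[v vH v0].
  have := pos (v^t*); rewrite formE trmxCK vH -scalemxAl mxE.
  rewrite vnormE trmxCK -mulrBl pmulr_lge0; first by rewrite subr_ge0 lecR.
  have := mul_trmxC_ge0 (v^t*); rewrite trmxCK le_eqVlt => /orP[|//].
  rewrite eq_sym -{1}[v]trmxCK mul_trmxC_eq0 => /eqP vt0.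
  by move: v0; rewrite -[v]trmxCK vt0 trmx0 map_mx0 eqxx.
apply/le_anti/andP; split; first by apply: ge_sup => //; exists m.
by apply: ub_le_sup => //; exists m.
Qed.
End LambdaMax.

(** * Polar form and principal argument *)

Section Argument.
Variable R : realType.

Lemma expi_inj (t u : R) : - pi < t <= pi -> - pi < u <= pi ->
  expi t = expi u -> t = u.
Proof.
move=> tpi upi [ct st].
have absI (x : R) : - pi < x <= pi -> `|x| \in `[0, pi].
  by move=> /andP[? ?]; rewrite in_itv /= normr_ge0 ler_norml ltW.
have : `|t| = `|u| by apply: cos_inj; rewrite ?absI // !cos_norm.
move/eqP; rewrite eqr_norm2 => /orP[/eqP//|/eqP tu].
(* If [t = - u] and [t != u], the larger angle lies in []0, pi[], where the sine is positive: it
   cannot be [pi], since [- pi] is excluded from the range. *)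
have st0 : sin t = 0.
  have : sin t = - sin t by rewrite {2}tu sinN opprK.
  lra.
have [u0|u0|//] := ltgtP t u.
- have : 0 < sin u by apply: sin_gt0_pi; lra.
  by rewrite -st st0 ltxx.
- have : 0 < sin t by apply: sin_gt0_pi; lra.
  by rewrite st0 ltxx.
Qed.

Lemma norm_expi (t : R) : `|expi t| = 1.
Proof. by rewrite normc_def /= cos2Dsin2 sqrtr1. Qed.

Lemma expiNM (t : R) : expi t * expi (- t) = 1.
Proof.
rewrite /expi cosN sinN; apply/eqP; rewrite eq_complex /=.
by apply/andP; split; apply/eqP; [rewrite -[RHS](cos2Dsin2 t)|]; ring.
Qed.

(** [xget] picks some member of the set; [t] is one, and [expi_inj] makes it the only one. *)
Lemma Arg_polar (a t : R) : 0 < a -> - pi < t <= pi ->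
  Arg (a%:C * expi t) = t.
Proof.
move=> a0 tpi; rewrite /Arg.
have norma : `|a%:C * expi t| = a%:C.
  by rewrite normrM norm_expi mulr1 ger0_norm // ler0c ltW.
case: xgetP => [u _ [upi]|/(_ t)[]]; last by rewrite norma.
rewrite norma => /mulfI; rewrite eq_complex /= gt_eqF //= => /(_ isT) tu.
exact/esym/expi_inj.
Qed.

Lemma Arg_gt0_Re (a b : R) : 0 < a -> Arg (a +i* b) = atan (b / a).
Proof.
move=> a0; set t := atan (b / a).
have ct0 : 0 < cos t by rewrite cos_gt0_pihalf // atan_gtNpi2 atan_ltpi2.
(* The modulus is [a / cos t] because the real part is [a]. *)
have -> : a +i* b = (a / cos t)%:C * expi t.
  have : tan t = b / a by rewrite atanK.
  rewrite /tan => tt; apply/eqP; rewrite eq_complex /= !mul0r subr0 addr0.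
  apply/andP; split; apply/eqP; first by rewrite divfK // gt_eqF.
  by rewrite mulrAC -mulrA tt mulrCA divff ?mulr1 // gt_eqF.
rewrite Arg_polar ?divr_gt0 //.
have := atan_gtNpi2 (b / a); have := atan_ltpi2 (b / a); have := pi_gt0 R.
by rewrite -/t; lra.
Qed.

Lemma half_angle_tan (t : R) : 0 < t < pi -> tan (t / 2) = (1 - cos t) / sin t.
Proof.
move=> tpi; set h := t / 2.
have -> : t = h *+ 2 by rewrite /h; lra.
have sh : 0 < sin h by apply: sin_gt0_pi; rewrite /h; lra.
have ch : 0 < cos h by apply: cos_gt0_pihalf; rewrite /h; lra.
rewrite cos_mulr2n cos2sin2 sin_mulr2n /tan.
by field; rewrite !gt_eqF.
Qed.

End Argument.

(** * Supporting lines and corners of a disk *)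

Section Disk.
Variables (R : realType) (n : nat).
Implicit Types K M : 'M[R[i]]_n.

Lemma field_of_values_affine K (a b : R[i]) :
  field_of_values (a *: 1%:M + b *: K) =
  [set a + b * w | w in field_of_values K].
Proof.
have formE (x : 'cV_n) : vnorm x = 1 ->
    (x^t* *m (a *: 1%:M + b *: K) *m x) 0 0 = a + b * (x^t* *m K *m x) 0 0.
  move=> x1; rewrite mulmxDr mulmxDl -!scalemxAr mulmx1 -!scalemxAl mxE.
  by rewrite [X in X + _]mxE [X in _ + X]mxE -vnormE x1 expr1n mulr1.
apply/seteqP; split=> z.
- by case=> x x1 <-; exists ((x^t* *m K *m x) 0 0); [exists x | rewrite formE].
- by case=> _ [x x1 <-] <-; exists x => //; rewrite formE.
Qed.

Lemma Re_le_norm1 (w : R[i]) : `|w| <= 1 -> complex.Re w <= 1.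
Proof.
move=> w1; rewrite -lecR (le_trans _ w1) // (le_trans _ (normc_ge_Re w)) //.
by rewrite lecR ler_norm.
Qed.

(** A real part [1] uses up the norm bound, leaving a zero imaginary part; this makes the point of
    tangency unique. *)
Lemma norm1_Re_eq1 (w : R[i]) : `|w| <= 1 -> complex.Re w = 1 -> w = 1.
Proof.
case: w => x y; rewrite normc_def lecR /= => + x1; rewrite {}x1.
rewrite -[X in _ <= X -> _]sqrtr1 ler_psqrt ?nnegrE ?ler01 ?addr_ge0 ?sqr_ge0 //.
rewrite expr1n gerDl => y0.
have /eqP : y ^+ 2 == 0 by rewrite eq_le y0 sqr_ge0.
by move=> /eqP; rewrite sqrf_eq0 => /eqP ->.
Qed.

Lemma supporting_lineE M theta (z : R[i]) : supporting_line M theta z ->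
  complex.Re (expi theta * z) = lambda_max M theta.
Proof. by case=> t _ <-; rewrite mulrA expiNM mul1r. Qed.

Section UnitDisk.
Variables (K M : 'M[R[i]]_n) (s rt : R).
Hypothesis rt_gt0 : 0 < rt.
Hypothesis KE : field_of_values K = [set z : R[i] | `|z| <= 1].
Hypothesis ME : M = s%:C *: 1%:M + rt%:C *: K.

Let Re_rotate theta (w : R[i]) :
  complex.Re (expi theta * (s%:C + rt%:C * w)) =
  s * cos theta + rt * complex.Re (expi theta * w).
Proof. by case: w => x y /=; ring. Qed.

Lemma lambda_max_disk theta : lambda_max M theta = s * cos theta + rt.
Proof.
apply: lambda_max_support; rewrite ME field_of_values_affine KE.
- move=> _ [w /= w1 <-]; rewrite Re_rotate lerD2l ler_piMr ?(ltW rt_gt0) //.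
  by apply: Re_le_norm1; rewrite normrM norm_expi mul1r.
(* The maximum is attained at the point that rotation by [theta] sends to [1]. *)
- exists (s%:C + rt%:C * expi (- theta)).
    by exists (expi (- theta)) => //=; rewrite norm_expi.
  by rewrite Re_rotate expiNM mulr1.
Qed.

Lemma tangent_point theta z :
  (field_of_values M `&` supporting_line M theta) z ->
  z = s%:C + rt%:C * expi (- theta).
Proof.
case; rewrite ME field_of_values_affine KE -ME => -[w /= w1 <-].
move=> /supporting_lineE; rewrite Re_rotate lambda_max_disk.
move=> /addrI /eqP; rewrite -[X in _ == X]mulr1.
move=> /eqP /(mulfI (lt0r_neq0 rt_gt0)) Re1; congr (_ + _ * _).
have e1 : expi theta * w = 1.
  by apply: norm1_Re_eq1 => //; rewrite normrM norm_expi mul1r.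
by rewrite -[w]mul1r -(expiNM theta) mulrAC e1 mul1r.
Qed.

(** The first line fixes the abscissa [s + rt]; the second then reads
    [y sin phi = rt (1 - cos phi)], where [sin phi > 0]. *)
Lemma cornerE phi c : 0 < phi < pi ->
  (supporting_line M 0 `&` supporting_line M (- phi)) c ->
  c = (s + rt) +i* (rt * tan (phi / 2)).
Proof.
move=> phi_pi [/supporting_lineE + /supporting_lineE].
have sin_phi : 0 < sin phi by exact: sin_gt0_pi.
rewrite !lambda_max_disk half_angle_tan //; case: c => x y /=.
rewrite !cosN !sinN cos0 sin0 mul0r subr0 mul1r mulr1 => -> eq_y.
congr (_ +i* _); rewrite mulrA.
apply: (canRL (mulfK _)); first by rewrite gt_eqF.
by move: eq_y; rewrite mulNr; lra.
Qed.

End UnitDisk.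
End Disk.

(** * The half-angle map and its iterates *)

Section HalfAngleMap.
Variable R : realType.
Implicit Types (mu x : R) (phi : nat -> R).

(** As [mu <= 1] and [atan] increases, the value is at most [atan (tan (x / 2))]. *)
Lemma half_angle_map_bounds mu x : 0 < mu <= 1 -> 0 < x < pi ->
  0 < atan (mu * tan (x / 2)) <= x / 2.
Proof.
move=> /andP[mu0 mu1] xpi.
have tan_gt0 : 0 < tan (x / 2).
  by rewrite divr_gt0 ?sin_gt0_pi ?cos_gt0_pihalf //; lra.
apply/andP; split; first by rewrite -[X in X < _]atan0 lt_atan // mulr_gt0.
rewrite -[leRHS]tanK; last by rewrite in_itv /=; lra.
by rewrite le_atan // ler_piMl // ltW.
Qed.

Lemma is_derive_half_angle_map mu :
  is_derive (0 : R) (1 : R) (fun x => atan (mu * tan (x / 2))) (mu / 2).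
Proof.
(* The base points [0 / 2] and [tan (0 / 2)] stay unreduced to match those of the chain rule. *)
have dtan : is_derive (0 / 2 : R) (1 : R) (@tan R) 1.
  have := @is_derive_tan R (0 / 2); rewrite mul0r cos0 expr1n invr1; apply.
  by rewrite oner_eq0.
have datan : is_derive (mu * tan (0 / 2) : R) (1 : R) (@atan R) 1.
  have := @is_derive1_atan R (mu * tan (0 / 2)).
  by rewrite mul0r tan0 mulr0 expr0n addr0 invr1.
have dhalf : is_derive (0 : R) (1 : R) (fun x => x / 2) (2^-1 : R).
  by apply: is_derive_eq; rewrite /GRing.scale /=; lra.
have dmul : is_derive (tan (0 / 2) : R) (1 : R) ( *%R mu) mu.
  by apply: is_derive_eq; rewrite /GRing.scale /= mulr1.
have d1 := @is_derive1_comp R (@tan R) (fun x => x / 2) 0 _ _ dtan dhalf.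
have d2 := @is_derive1_comp R ( *%R mu) _ 0 _ _ dmul d1.
have := @is_derive1_comp R (@atan R) _ 0 _ _ datan d2.
by rewrite !mul1r.
Qed.

Lemma half_angle_map_Qlinear mu j phi : 0 < mu <= 1 -> 0 < phi j < pi ->
  (forall k, (j <= k)%N -> phi k.+1 = atan (mu * tan (phi k / 2))) ->
  Qlinear j phi 0 (mu / 2).
Proof.
move=> mu01 phij rec.
(* The bound also keeps each iterate below [pi], which is what allows the next halving. *)
have bnd m : 0 < phi (m + j)%N <= phi j / 2 ^+ m.
  elim: m => [|m /andP[IH0 IH]].
    by rewrite expr0 divr1 lexx andbT; case/andP: phij.
  have phim : 0 < phi (m + j)%N < pi.
    rewrite IH0 (le_lt_trans IH) // (le_lt_trans _ (andP phij).2) //.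
    rewrite ler_pdivrMr ?exprn_gt0 // ler_peMr ?(ltW (andP phij).1) //.
    by rewrite exprn_ege1 // ler1n.
  have := half_angle_map_bounds mu01 phim; rewrite -rec ?leq_addl // addSn.
  move=> /andP[-> /= le2]; rewrite (le_trans le2) // exprSr invfM mulrA.
  by rewrite ler_pM2r ?invr_gt0.
have phi_gt0 k : (j <= k)%N -> 0 < phi k.
  by move=> jk; have := bnd (k - j)%N; rewrite subnK // => /andP[].
have phi_cvg : phi k @[k --> \oo] --> (0 : R).
  rewrite -(cvg_shiftn j) /=.
  apply: (@squeeze_cvgr _ _ _ _ (fun=> 0) (fun m => phi j / 2 ^+ m)).
  - by apply: nearW => m; have /andP[/ltW -> ->] := bnd m.
  - exact: cvg_cst.
  - have := @cvg_geometric R (phi j) 2^-1.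
    rewrite ger0_norm ?invr_ge0 // invf_lt1 ?ltr1n // => /(_ isT).
    by apply: cvg_trans; apply: near_eq_cvg; near=> m; rewrite /geometric /= exprVn.
split=> //.
- by case/andP: mu01 => *; lra.
- by move=> k /phi_gt0 /gt_eqF ->.
(* The derivative is a limit over a punctured neighbourhood, so the iterates must also be
   nonzero. *)
have phi_cvg' : phi k @[k --> \oo] --> (0 : R)^'.
  move=> A /phi_cvg A0; apply: filterS2 (nbhs_infty_ge j) A0 => k jk.
  by apply; exact/lt0r_neq0/phi_gt0.
(* The map vanishes at [0], so its difference quotient there, taken along [phi k], is the ratio of
   successive iterates for [k >= j]. *)
have [/[swap] dval dcvg] := is_derive_half_angle_map mu.
rewrite -dval.
apply: cvg_trans (cvg_comp _ _ phi_cvg' dcvg).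
apply: near_eq_cvg; near=> k => /=.
have jk : (j <= k)%N by near: k; exact: nbhs_infty_ge.
rewrite !subr0 !gtr0_norm ?phi_gt0 ?(leq_trans jk) // rec //.
rewrite [_%:A]mulr1 addr0 mul0r tan0 mulr0 atan0 subr0.
by rewrite /GRing.scale /= mulrC.
Unshelve. all: by end_near. Qed.
End HalfAngleMap.

Theorem theorem4p8 (R : realType) (n : nat) (K M : 'M[R[i]]_n)
    (s rt r mu : R) (j : nat) (phi theta : nat -> R) (b c : nat -> R[i])
    (hn : (2 <= n)%N)
    (hs : 0 <= s) (hrt : 0 < rt)
    (hK : field_of_values K = [set z : R[i] | `|z| <= 1])
    (hM : M = s%:C *: 1%:M + rt%:C *: K)
    (hr : r = s + rt) (hmu : mu = rt / r)
    (hphij : 0 < phi j < pi)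
    (hcuts : uhlig_clockwise_cuts M s rt j phi theta b c) :
  (forall k, (j <= k)%N -> phi k.+1 = atan (mu * tan (phi k / 2))) /\
  Qlinear j phi 0 (mu / 2).
Proof.
have r0 : 0 < r by rewrite hr; lra.
have mu01 : 0 < mu <= 1.
  by rewrite hmu divr_gt0 //= ler_pdivrMr // mul1r hr lerDr.
have [_ hc htheta hb hphi] := hcuts.
(* The recursion at [k] needs [phi k] in []0, pi[], which itself comes from the recursion; hence
   this conditional form, followed by an induction for the range. *)
have step k : (j <= k)%N -> 0 < phi k < pi ->
    phi k.+1 = atan (mu * tan (phi k / 2)).
  move=> jk phik; have cE := cornerE hrt hK hM phik (hc k jk).
  have bE := tangent_point hrt hK hM (hb k jk).
  have ArgcE : Arg (c k) = atan (mu * tan (phi k / 2)).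
    by rewrite cE -hr Arg_gt0_Re // hmu mulrAC.
  (* [b k.+1 - s] is [rt] times [expi (Arg (c k))], and an arctangent lies within the principal
     range. *)
  rewrite hphi // bE addrC addKr htheta // opprK ArgcE Arg_polar //.
  set a := mu * _; have := atan_gtNpi2 a; have := atan_ltpi2 a.
  by have := pi_gt0 R; lra.
have range k : (j <= k)%N -> 0 < phi k < pi.
  elim: k => [|k IH]; first by rewrite leqn0 => /eqP <-.
  rewrite leq_eqVlt => /predU1P[<- //|jk]; have phik := IH jk.
  have := half_angle_map_bounds mu01 phik; rewrite -step //; lra.
have recursion k : (j <= k)%N -> phi k.+1 = atan (mu * tan (phi k / 2)).
  by move=> jk; apply: step => //; apply: range.
by split=> //; apply: half_angle_map_Qlinear.
Qed.
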